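(* Consider the two-way unsplittable trading problem with at most $k\ge 2$ trades, where all prices lie in some interval $[m,M]$ with $M/m=\varphi>1$, and only $\varphi$ (not $m$ or $M$) is known to the online algorithm. For every $\epsilon>0$, no deterministic online algorithm has competitive ratio smaller than $\varphi^{(2k+2)/3-\epsilon}$.
   Context: Two-way unsplittable trading problem: a sequence of prices $p(1),\ldots,p(T)$ (positive reals), one per day, is revealed online; the horizon length $T$ is not known to the online algorithm in advance, but when day $i$ arrives the algorithm learns whether $i=T$. The investor starts with cash and may make at most $k$ trades. A trade is a pair of days $(b,s)$ with $b<s$: on day $b$ all available money is used to buy the stock at price $p(b)$, and on day $s$ all stock is sold at price $p(s)$. Trades cannot overlap (a sale must happen before the next purchase), there is no short selling, no buying on the last day $T$, and any stock held on day $T$ is sold at price $p(T)$. The gain of a trade $(b,s)$ is $p(s)/p(b)$; the return is the product of the gains of the trades made ($1$ if none). OPT is the optimal offline algorithm making at most $k$ trades. The competitive ratio of an online algorithm is the supremum over admissible price sequences of (return of OPT)/(return of the algorithm). In this model the admissible price sequences are those whose prices all lie in some interval $[m,M]$ with $M/m=\varphi$; only $\varphi$ is known to the algorithm. *)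

(* Defs.v *)
From HB Require Import structures.
From mathcomp Require Import all_boot all_order all_algebra.
From mathcomp Require Import all_classical all_reals all_analysis.

Set Implicit Arguments.
Unset Strict Implicit.
Unset Printing Implicit Defensive.
Import Order.TTheory GRing.Theory Num.Theory.
Local Open Scope classical_set_scope.
Local Open Scope ring_scope.

(* A price sequence p(1), ..., p(T) is a list p of length T; days are numbered
   from 0, so that p`_i is the price p(i+1) and T - 1 is the last day.  A trade
   is a pair (b, s) of days. *)
Definition trade := (nat * nat)%type.

Definition admissible (R : realType) (phi : R) (p : seq R) : Prop :=
  (0 < size p)%N /\
  exists m M : R, [/\ 0 < m, M / m = phi & forall x, x \in p -> m <= x <= M].

Definition trading_return (R : realType) (p : seq R) (ts : seq trade) : R :=
  \prod_(t <- ts) (p`_t.2 / p`_t.1).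

Definition feasible (R : realType) (k : nat) (p : seq R) (ts : seq trade) : bool :=
  [&& (size ts <= k)%N,
      all (fun t : trade => (t.1 < t.2 < size p)%N) ts
    & sorted (fun t u : trade => (t.2 < u.1)%N) ts].

Definition opt (R : realType) (k : nat) (p : seq R) : R :=
  sup [set trading_return p ts | ts in [set ts | feasible k p ts]].

Variant action := Wait | Buy | Sell.

(* A deterministic online algorithm: its arguments are the prices of all days
   up to and including the current one, and whether the current day is the
   last one. *)
Definition online_algorithm (R : realType) := seq R -> bool -> action.

(* State of the execution: the day of purchase of the stock currently held, if
   any, and the completed trades.  Impossible actions (buying while holding
   stock or on the last day, selling without stock) have no effect, and stock
   held on the last day is sold whatever the action. *)
Definition step (R : realType) (A : online_algorithm R) (p : seq R)
    (st : option nat * seq trade) (i : nat) : option nat * seq trade :=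
  let last_day := i.+1 == size p in
  match st.1, A (take i.+1 p) last_day with
  | None, Buy => if last_day then st else (Some i, st.2)
  | None, _ => st
  | Some b, Sell => (None, rcons st.2 (b, i))
  | Some b, _ => if last_day then (None, rcons st.2 (b, i)) else st
  end.

Definition trades (R : realType) (A : online_algorithm R) (p : seq R) : seq trade :=
  (foldl (step A p) (None, [::]) (iota 0 (size p))).2.

Definition makes_at_most (R : realType) (k : nat) (phi : R)
    (A : online_algorithm R) : Prop :=
  forall p : seq R, admissible phi p -> (size (trades A p) <= k)%N.

Definition competitive_ratio (R : realType) (k : nat) (phi : R)
    (A : online_algorithm R) : \bar R :=
  ereal_sup [set (opt k p / trading_return p (trades A p))%:E
            | p in [set p | admissible phi p]].

(* Main.v *)
Require Import Defs.
From HB Require Import structures.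
From mathcomp Require Import all_boot all_order all_algebra.
From mathcomp Require Import all_classical all_reals all_analysis.
From mathcomp Require Import zify ring lra.

Set Implicit Arguments.
Unset Strict Implicit.
Unset Printing Implicit Defensive.
Import Order.TTheory GRing.Theory Num.Theory.
Local Open Scope ring_scope.

(** Take all prices of the form [q ^ x] with [x] an integer and [q ^ (3 n) = phi],
    so that every return becomes an integer sum of log-prices, and play on a
    window [lo, hi] of log-width [3 n].

    At [hi], with [j] trades left for OPT, the adversary visits the levels
    [hi - 1], [hi - 2], ... in turn, going [j] times from each level back to [hi].
    When the algorithm first buys, the price collapses to [lo].  If the purchase
    was low, OPT has already harvested [j] almost equally deep oscillations;
    if it was high, the loss of the algorithm is large and the game goes on at
    [lo].  At [lo], the price goes [j] times to [lo + 2 n] and back; as soon as the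
    algorithm is out of the market, the price jumps to [hi], and the
    oscillations already made are simply ignored by OPT, so that this costs it one
    trade only.  By induction on [j] the adversary gains [(2 j + 1) n - j] from [hi] and
    [2 j n - j] from [lo].

    As the window is unknown, a purchase on the first day is answered by a full
    drop and a refusal to buy by a full rise; either way the adversary is [3 n]
    ahead, for a total of [(2 k + 2) n - k].  The term [k], due to the unit step of the
    descent, is negligible for [n] large. *)

(** * Trades and returns in integer log-prices *)

Definition valid_trades (k T : nat) (ts : seq trade) : bool :=
  [&& (size ts <= k)%N,
      all (fun t : trade => (t.1 < t.2 < T)%N) ts
    & sorted (fun t u : trade => (t.2 < u.1)%N) ts].

Definition log_gain (s : seq int) (ts : seq trade) : int :=
  \sum_(t <- ts) (s`_t.2 - s`_t.1).

Definition achieves (s : seq int) (k : nat) (g : int) : Prop :=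
  exists2 ts, valid_trades k (size s) ts & log_gain s ts = g.

(* An online algorithm is abstracted to the boolean [hold], telling from the
   price history whether it holds stock at the end of the day; [log_value] is
   its log-return with the stock held marked to market at the last price. *)
Definition log_value (hold : seq int -> bool) (s : seq int) : int :=
  \sum_(0 <= i < (size s).-1)
    if hold (take i.+1 s) then s`_i.+1 - s`_i else 0.

Definition in_window (c N : int) (s : seq int) : bool :=
  all (fun x => c <= x <= c + N) s.

Lemma achieves0 s k : achieves s k 0.
Proof. by exists [::]; rewrite /log_gain ?big_nil. Qed.

Lemma achieves_prefix h s k k' g :
  prefix h s -> (k <= k')%N -> achieves h k g -> achieves s k' g.
Proof.
move=> /prefixP[t ->] le_k [ts /and3P[sz_ts ts_in srt] <-].
exists ts; first apply/and3P; first split=> //; first exact: leq_trans le_k.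
- apply: sub_all ts_in => x /andP[-> /=].
  by rewrite size_cat => /leq_trans -> //; exact: leq_addr.
- apply: eq_big_seq => x /(allP ts_in) /andP[lt12 lt2].
  by rewrite !nth_cat lt2 (ltn_trans lt12 lt2).
Qed.

(** The purchase comes after all of [h], so it cannot overlap earlier trades; OPT sits through
    [t]. *)
Lemma achieves_trade h b t x k g :
  achieves h k g -> achieves (h ++ b :: rcons t x) k.+1 (g + (x - b)).
Proof.
move=> [ts /and3P[sz_ts ts_in srt] <-].
have szE : size (h ++ b :: rcons t x) = (size h + (size t).+2)%N.
  by rewrite size_cat /= size_rcons.
exists (rcons ts (size h, size h + (size t).+1)%N).
  apply/and3P; split; first by rewrite size_rcons.
  - rewrite all_rcons /= szE; apply/andP; split; first by lia.
    by apply: sub_all ts_in => y; lia.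
  - case: ts srt ts_in {sz_ts} => //= y ts srt /andP[y_in ts_in].
    rewrite rcons_path srt /=.
    have : last y ts \in y :: ts by exact: mem_last.
    by rewrite inE => /orP[/eqP->|/(allP ts_in)]; lia.
rewrite /log_gain big_rcons /=; congr (_ + _).
  apply: eq_big_seq => y /(allP ts_in) y_in.
  by rewrite !nth_cat !ifT //; lia.
rewrite !nth_cat ltnn subnn /= ltnNge leq_addr /= addKn /=.
by rewrite nth_rcons ltnn eqxx.
Qed.

Lemma achieves_next h b x k g :
  achieves h k g -> achieves (rcons (rcons h b) x) k.+1 (g + (x - b)).
Proof. by move=> /(achieves_trade b [::] x); rewrite /= -!cat_rcons cats0. Qed.

Lemma achieves_skip h b z x k g : achieves h k g ->
  achieves (rcons (rcons (rcons h b) z) x) k.+1 (g + (x - b)).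
Proof.
by move=> /(achieves_trade b [:: z] x); rewrite /= -!cat_rcons cats0.
Qed.

Lemma log_value_rcons hold h a x :
  log_value hold (rcons (rcons h a) x) =
  log_value hold (rcons h a) + if hold (rcons h a) then x - a else 0.
Proof.
rewrite /log_value !size_rcons /= big_nat_recr //=; congr (_ + _).
  apply: eq_big_nat => i /andP[_ lt_i].
  rewrite -[rcons (rcons h a) x]cats1 takel_cat ?size_rcons //; last by lia.
  by rewrite !nth_cat size_rcons !ltnS lt_i ltnW.
rewrite -[rcons (rcons h a) x]cats1 takel_cat ?size_rcons //.
rewrite -[X in take X (rcons h a)](size_rcons h a) take_size.
by rewrite !nth_cat size_rcons ltnn ltnSn subnn /= nth_rcons ltnn eqxx.
Qed.

(** * The adversary on a fixed window *)

Section Adversary.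

Variables (hold : seq int -> bool) (n c : int).
Hypothesis n_gt0 : 0 < n.

Local Notation W := (log_value hold).
Local Notation lo := c.
Local Notation hi := (c + n *+ 3).
Local Notation ok := (in_window c (n *+ 3)).

(** As [hold] is a fixed function, adaptive play amounts to one well-chosen continuation [s]. *)
Definition beats (h : seq int) (k : nat) (v : int) : Prop :=
  exists s : seq int, [/\ prefix h s, ok s &
    exists2 g, achieves s k g & v <= g - W s].

Lemma beats_prefix h h' k v v' :
  prefix h h' -> v <= v' -> beats h' k v' -> beats h k v.
Proof.
move=> hh' vv' [s [h's oks [g ag le_g]]]; exists s; split=> //.
- exact: prefix_trans h's.
- by exists g => //; exact: le_trans le_g.
Qed.

Definition high_value (j : nat) : Prop :=
  forall (h : seq int) i g, ok (rcons h hi) -> achieves (rcons h hi) i g ->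
    beats (rcons h hi) (i + j) (g - W (rcons h hi) + n * (2 * j + 1)%:Z - j%:Z).

(* [h] excludes the last day, at price [lo], on which OPT may still buy. *)
Definition low_value (j : nat) : Prop :=
  forall (h : seq int) i g, ok (rcons h lo) -> achieves h i g ->
    beats (rcons h lo) (i + j) (g - W (rcons h lo) + n * (2 * j)%:Z - j%:Z).

Lemma ok_rcons h x : ok (rcons h x) = (c <= x <= c + n *+ 3) && ok h.
Proof. by rewrite /in_window all_rcons. Qed.

Lemma rise_or_oscillate (h : seq int) i g m : ok (rcons h lo) -> achieves h i g ->
  (exists h1 : seq int, [/\ prefix (rcons h lo) (rcons h1 lo), ok (rcons h1 lo),
     prefix h h1, achieves h1 (i + m) (g + n * (2 * m)%:Z)
     & W (rcons h1 lo) = W (rcons h lo)]) \/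
  (exists h2 : seq int, [/\ prefix (rcons h lo) (rcons h2 hi), ok (rcons h2 hi),
     achieves (rcons h2 hi) i.+1 (g + n *+ 3)
     & W (rcons h2 hi) <= W (rcons h lo) + n *+ 2]).
Proof.
move=> okh ah; elim: m => [|m [[h1 [pre1 ok1 pre1' a1 W1]]|]]; last by right.
  by left; exists h; rewrite !prefix_refl addn0 mulr0 addr0.
have a1' : achieves h1 i g by exact: achieves_prefix ah.
have [in1|out1] := boolP (hold (rcons h1 lo)); last first.
  right; exists (rcons h1 lo); split.
  - exact: prefix_trans (prefix_rcons _ _).
  - by rewrite ok_rcons ok1; lia.
  - by move: (achieves_next lo hi a1'); congr achieves; lia.
  - by rewrite log_value_rcons (negbTE out1); lia.
(* Each oscillation to [z] earns OPT [2 n], the value required per trade, while a sale at [z] still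
   leaves OPT [n] further ahead after the jump to [hi]. *)
set z := c + n *+ 2.
have [in2|out2] := boolP (hold (rcons (rcons h1 lo) z)); last first.
  right; exists (rcons (rcons h1 lo) z); split.
  - apply: prefix_trans (prefix_rcons _ _).
    exact: prefix_trans (prefix_rcons _ _).
  - by rewrite !ok_rcons; move: ok1; rewrite ok_rcons => /andP[_ ->]; lia.
  - by move: (achieves_skip lo z hi a1'); congr achieves; lia.
  - by rewrite 2!log_value_rcons (negbTE out2) in1; lia.
left; exists (rcons (rcons h1 lo) z); split.
- apply: prefix_trans (prefix_rcons _ _).
  exact: prefix_trans (prefix_rcons _ _).
- by rewrite !ok_rcons; move: ok1; rewrite ok_rcons => /andP[_ ->]; lia.
- apply: (prefix_trans pre1'); apply: prefix_trans (prefix_rcons _ _).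
  exact: prefix_rcons.
- by rewrite addnS; move: (achieves_next lo z a1); congr achieves; lia.
- by rewrite 2!log_value_rcons in1 in2; lia.
Qed.

Lemma low_value_step j : high_value j -> low_value j.+1.
Proof.
move=> Hj h i g okh ah.
have [[h1 [pre1 ok1 _ a1 W1]]|[h2 [pre2 ok2 a2 W2]]] :=
  rise_or_oscillate j.+1 okh ah.
  exists (rcons h1 lo); split=> //; exists (g + n * (2 * j.+1)%:Z).
    by apply: achieves_prefix a1 => //; exact: prefix_rcons.
  by rewrite W1; lia.
apply: beats_prefix pre2 _ _; last first.
  by rewrite addnS -addSn; exact: Hj a2.
by nia.
Qed.

(* In the second case the algorithm bought at [hi - e], having refused to do so
   during [j] visits to [hi - e.-1]; [e = 0] stands for a purchase at [hi]. *)
Lemma drop_or_descend (h : seq int) i g j d : (d%:Z <= n *+ 3) ->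
  ok (rcons h hi) -> achieves (rcons h hi) i g ->
  (exists h1 : seq int, [/\ prefix (rcons h hi) (rcons h1 hi), ok (rcons h1 hi),
     achieves (rcons h1 hi) (i + j) (g + (d * j)%:Z)
     & W (rcons h1 hi) = W (rcons h hi)]) \/
  (exists (h2 : seq int) (e : nat), [/\ prefix (rcons h hi) h2, ok (rcons h2 lo),
     achieves h2 (i + j) (g + (e.-1 * j)%:Z)
     & W (rcons h2 lo) <= W (rcons h hi) - (n *+ 3 - e%:Z)]).
Proof.
move=> d_le okh ah; elim: d d_le => [_|d IHd d_le].
  left; exists h; rewrite prefix_refl mul0n addr0; split=> //.
  exact: (achieves_prefix (prefix_refl _) (leq_addr _ _) ah).
have [|[h1 [pre1 ok1 a1 W1]]|] := IHd; [by lia| |by right].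
(* The inner induction counts visits to level [d.+1]. OPT starts afresh from [h] there; [a1], the
   harvest of the level above, is kept for a purchase at this level. *)
suff IHm m : (exists h2 : seq int, [/\ prefix (rcons h1 hi) (rcons h2 hi),
       ok (rcons h2 hi), achieves (rcons h2 hi) (i + m) (g + (d.+1 * m)%:Z)
       & W (rcons h2 hi) = W (rcons h hi)]) \/
    (exists (h2 : seq int) (e : nat), [/\ prefix (rcons h hi) h2, ok (rcons h2 lo),
       achieves h2 (i + j) (g + (e.-1 * j)%:Z)
       & W (rcons h2 lo) <= W (rcons h hi) - (n *+ 3 - e%:Z)]).
  have [[h2 [pre2 ok2 a2 W2]]|] := IHm j; last by right.
  by left; exists h2; split=> //; exact: prefix_trans pre2.
elim: m => [|m [[h2 [pre2 ok2 a2 W2]]|]]; last by right.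
  left; exists h1; rewrite prefix_refl addn0 muln0 addr0; split=> //.
  exact: achieves_prefix ah.
have pre12 := prefix_trans pre1 pre2.
have [in2|out2] := boolP (hold (rcons h2 hi)).
  right; exists (rcons h2 hi), 0%N; split=> //.
  - by rewrite ok_rcons ok2; lia.
  - by rewrite mul0n addr0; exact: (achieves_prefix pre12 (leq_addr _ _) ah).
  - by rewrite log_value_rcons in2; lia.
set y := hi - d.+1%:Z.
have oky : ok (rcons (rcons h2 hi) y) by rewrite ok_rcons ok2; lia.
have pre3 : prefix (rcons h1 hi) (rcons (rcons h2 hi) y).
  exact: prefix_trans (prefix_rcons _ _).
have [in3|out3] := boolP (hold (rcons (rcons h2 hi) y)).
  right; exists (rcons (rcons h2 hi) y), d.+1; split=> //.
  - exact: prefix_trans pre3.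
  - by rewrite ok_rcons oky; lia.
  - exact: achieves_prefix a1.
  - by rewrite 2!log_value_rcons in3 (negbTE out2); lia.
left; exists (rcons (rcons h2 hi) y); split=> //.
- exact: prefix_trans (prefix_rcons _ _).
- by rewrite ok_rcons oky; lia.
- by rewrite addnS; move: (achieves_next y hi a2); congr achieves; lia.
- by rewrite 2!log_value_rcons (negbTE out2) (negbTE out3); lia.
Qed.

(** After a purchase at depth [e < 2 n], the loss [3 n - e] exceeds [n] and play resumes at [lo]
    with all [j] trades unspent. For [e >= 2 n], harvest plus loss is [(e - 1) j + 3 n - e], at
    least [(2 j + 1) n - j]. For [j = 1] the latter bound holds at every depth, which starts the
    induction. *)
Lemma high_value_step j : (0 < j)%N -> ((1 < j)%N -> low_value j) ->
  high_value j.
Proof.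
move=> j_gt0 Lj h i g okh ah.
have [|[h1 [pre1 ok1 a1 W1]]|[h2 [e [pre2 ok2 a2 W2]]]] :=
    @drop_or_descend h i g j `|n *+ 3|%N _ okh ah.
- by lia.
- exists (rcons h1 hi); split=> //; exists (g + (`|n *+ 3|%N * j)%:Z) => //.
  by rewrite W1; nia.
have pre2' : prefix (rcons h hi) (rcons h2 lo).
  exact: prefix_trans (prefix_rcons _ _).
have [early|late] := boolP ((1 < j)%N && (e%:Z < n *+ 2)).
  have /andP[j_gt1 e_lt] := early.
  apply: beats_prefix pre2' _ _; last first.
    apply: Lj => //; apply: achieves_prefix ah => //.
  by nia.
exists (rcons h2 lo); split=> //; exists (g + (e.-1 * j)%:Z).
  by apply: achieves_prefix a2 => //; exact: prefix_rcons.
move: late; rewrite negb_and -leqNgt -leNgt => /orP[j_le1|e_ge].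
  have -> : j = 1%N by lia.
  by lia.
by nia.
Qed.

Lemma high_value_pos j : high_value j.+1.
Proof.
elim: j => [|j IHj]; first exact: high_value_step.
by apply: high_value_step => // _; exact: low_value_step.
Qed.

End Adversary.

Lemma adversary_wins (hold : seq int -> bool) (n : int) (k : nat) :
  0 < n -> (1 < k)%N ->
  exists (s : seq int) (c g : int), [/\ (0 < size s)%N, in_window c (n *+ 3) s,
    achieves s k g & n * (2 * k + 2)%:Z - k%:Z <= g - log_value hold s].
Proof.
case: k => [|[|k]] // n_gt0 _.
have W0 : log_value hold [:: 0] = 0 by rewrite /log_value big_nil.
have W1 x : log_value hold [:: 0; x] = if hold [:: 0] then x else 0.
  by rewrite (log_value_rcons hold [::] 0 x) W0 add0r subr0.
have [in0|out0] := boolP (hold [:: 0]).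
  (* The first price becomes the top of the window: the purchase loses [3 n] and OPT keeps all its
     trades. *)
  have L := low_value_step n_gt0 (@high_value_pos hold n (- (n *+ 3)) n_gt0 k).
  have [||s [/size_prefix sz oks [g ag le_g]]] := L [:: 0] 0%N 0.
  - by rewrite /in_window /=; lia.
  - exact: achieves0.
  - exists s, (- (n *+ 3)), g; split=> //; first exact: leq_trans sz.
    by move: le_g; rewrite /= W1 in0; nia.
(* The first price becomes the bottom of the window: OPT spends one trade on the rise and has [k.+1]
   left. *)
have [||s [/size_prefix sz oks [g ag le_g]]] :=
  @high_value_pos hold n 0 n_gt0 k [:: 0] 1%N (0 + (0 + n *+ 3 - 0)).
- by rewrite /in_window /=; lia.
- exact: (achieves_trade 0 [::] _ (achieves0 [::] 0)).
- exists s, 0, g; split=> //; first exact: leq_trans sz.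
  by move: le_g; rewrite /= W1 (negbTE out0); nia.
Qed.

(** * Executions of online algorithms as holding rules *)

(** The latest action other than [Wait] decides, since impossible actions have no effect. The flag
    is [false] because only days before the last matter. *)
Fixpoint hold_upto (R : realType) (A : online_algorithm R) (p : seq R)
    (i : nat) : bool :=
  if i is i'.+1 then
    match A (take i p) false with
    | Buy => true
    | Sell => false
    | Wait => hold_upto A p i'
    end
  else false.

Lemma hold_upto_take (R : realType) (A : online_algorithm R) p m i :
  (i <= m)%N -> hold_upto A (take m p) i = hold_upto A p i.
Proof. by elim: i => //= i IHi lt_im; rewrite IHi ?(ltnW lt_im) // take_takel. Qed.

Lemma iota0_rcons n : iota 0 n.+1 = rcons (iota 0 n) n.
Proof. by rewrite -addn1 iotaD cats1. Qed.

Section Execution.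

Variables (R : realType) (A : online_algorithm R) (p : seq R).
Hypothesis p_neq0 : forall i, (i < size p)%N -> p`_i != 0.

(* The state is taken on the morning of day [i], and the stock is valued at the
   price of that day. *)
Lemma marked_to_market i : (i < size p)%N ->
  let st := foldl (step A p) (None, [::]) (iota 0 i) in
  isSome st.1 = hold_upto A p i /\
  trading_return p st.2 * (if st.1 is Some b then p`_i / p`_b else 1) =
  \prod_(0 <= l < i) if hold_upto A p l.+1 then p`_l.+1 / p`_l else 1.
Proof.
elim: i => [_|i IHi lt_i] st; rewrite {}/st.
  by rewrite /trading_return /= !big_nil mulr1.
have [] := IHi (ltnW lt_i).
rewrite iota0_rcons foldl_rcons big_nat_recr //=.
case: (foldl _ _ _) => -[b|] ts /= <- <-; rewrite /step /= (ltn_eqF lt_i);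
  case: (A _ _) => /=; rewrite /trading_return ?big_rcons /= ?mulr1; split=> //;
  by move: (p`_b)^-1 => w; field; exact: p_neq0 (ltnW lt_i).
Qed.

(** On the last day stock is sold at its market value and nothing is bought, so the marked-to-market
    value is the return. *)
Lemma trading_return_trades : (0 < size p)%N ->
  trading_return p (trades A p) =
  \prod_(0 <= l < (size p).-1)
    if hold_upto A p l.+1 then p`_l.+1 / p`_l else 1.
Proof.
rewrite /trades; case sz_p : (size p) => [//|T] _.
have [|_ <-] := @marked_to_market T; first by rewrite sz_p.
rewrite iota0_rcons foldl_rcons.
case: (foldl _ _ _) => -[b|] ts /=; rewrite /step /= sz_p eqxx;
  by case: (A _ _) => /=; rewrite /trading_return ?big_rcons /= ?mulr1.
Qed.

End Execution.

(** Bounds the set in [opt], so that its [sup] is a genuine least upper bound and not a default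
    value. *)
Lemma trading_return_le (R : realType) (phi : R) k p ts :
  1 <= phi -> admissible phi p -> feasible k p ts ->
  trading_return p ts <= phi ^+ k.
Proof.
move=> phi_ge1 [_ [m [M [m_gt0 phiE p_in]]]] /and3P[sz_ts ts_in _].
apply: (@le_trans _ _ (phi ^+ size ts)); last exact: ler_weXn2l.
rewrite /trading_return; elim: ts ts_in {sz_ts} => [|t ts IH] /=.
  by rewrite big_nil.
case/andP=> /andP[lt12 lt2] /IH{}IH; rewrite big_cons exprS.
have /andP[le2 ge2] := p_in _ (mem_nth 0 lt2).
have /andP[le1 ge1] := p_in _ (mem_nth 0 (ltn_trans lt12 lt2)).
have p1_gt0 := lt_le_trans m_gt0 le1.
have phi_ge0 : 0 <= phi by exact: le_trans phi_ge1.
have q_ge0 : 0 <= p`_t.2 / p`_t.1.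
  by rewrite divr_ge0 ?(ltW p1_gt0) // (le_trans (ltW m_gt0)).
have q_le : p`_t.2 / p`_t.1 <= phi.
  rewrite ler_pdivrMr // (le_trans ge2) // -phiE mulrAC ler_pdivlMr //.
  by rewrite ler_wpM2l // (le_trans (ltW m_gt0)) // (le_trans le1).
apply: le_trans (ler_wpM2l q_ge0 IH) _.
by apply: ler_wpM2r q_le; rewrite exprn_ge0.
Qed.

Lemma opt_ge (R : realType) (phi : R) k p ts :
  1 <= phi -> admissible phi p -> feasible k p ts ->
  trading_return p ts <= opt k p.
Proof.
move=> phi_ge1 p_adm ts_feas; apply: ub_le_sup; last by exists ts.
by exists (phi ^+ k) => _ [us us_feas <-]; exact: trading_return_le us_feas.
Qed.

(** * From integer exponents back to prices *)

Section Exponents.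

Variables (R : realType) (q : R).
Hypothesis q_gt1 : 1 < q.

Definition prices (s : seq int) : seq R := [seq q ^ x | x <- s].

Let q_gt0 : 0 < q. Proof. exact: lt_trans q_gt1. Qed.
Let q_neq0 : q != 0. Proof. exact: lt0r_neq0. Qed.

Lemma expz_sub (x y : int) : q ^ (x - y) = q ^ x / q ^ y.
Proof. by rewrite expfzDr // -invr_expz. Qed.

Lemma nth_prices s i : (i < size s)%N -> (prices s)`_i = q ^ s`_i.
Proof. by move=> lt_i; rewrite (nth_map 0). Qed.

Lemma trading_return_prices s k ts : valid_trades k (size s) ts ->
  trading_return (prices s) ts = q ^ log_gain s ts.
Proof.
case/and3P=> _ /allP ts_in _; rewrite /log_gain /trading_return.
rewrite (big_morph (fun z => q ^ z) (fun x y => expfzDr x y q_neq0) (expr0z q)).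
apply: eq_big_seq => t /ts_in /andP[lt12 lt2].
by rewrite expz_sub !nth_prices // (ltn_trans lt12).
Qed.

Definition holds (A : online_algorithm R) (s : seq int) : bool :=
  hold_upto A (prices s) (size s).

Lemma trading_return_trades_prices A s : (0 < size s)%N ->
  trading_return (prices s) (trades A (prices s)) =
  q ^ log_value (holds A) s.
Proof.
move=> sz_s; rewrite trading_return_trades ?size_map //; last first.
  by move=> i lt_i; rewrite nth_prices // lt0r_neq0 // exprz_gt0.
rewrite /log_value.
rewrite (big_morph (fun z => q ^ z) (fun x y => expfzDr x y q_neq0) (expr0z q)).
apply: eq_big_nat => i lt_i; have lt_iS : (i.+1 < size s)%N by lia.
rewrite /holds size_takel; last exact: ltnW.
rewrite /prices map_take hold_upto_take // -/(prices s).
by case: ifP => _; rewrite ?expr0z // expz_sub !nth_prices // ltnW.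
Qed.

Lemma admissible_prices c (N : int) s : (0 < size s)%N -> in_window c N s ->
  admissible (q ^ N) (prices s).
Proof.
move=> sz_s /allP s_in; split; first by rewrite size_map.
exists (q ^ c), (q ^ (c + N)); split; first exact: exprz_gt0.
  by rewrite -expz_sub addrC addKr.
move=> _ /mapP[x /s_in /andP[le_cx le_x] ->].
by rewrite !ler_weXz2l // ltW.
Qed.

End Exponents.

Theorem theorem5 (R : realType) (k : nat) (phi eps : R)
  (k_ge2 : (2 <= k)%N) (phi_gt1 : 1 < phi) (eps_gt0 : 0 < eps) :
  ~ exists A : online_algorithm R,
      makes_at_most k phi A /\
      (competitive_ratio k phi A
         < (phi `^ ((2 * k + 2)%N%:R / 3%:R - eps))%:E)%E.
Proof.
move=> [A [_]]; apply/negP; rewrite -leNgt.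
(* The term [k] costs [k / (3 n)] in the exponent of [phi], at most [eps / 3] for this [n]. *)
pose n := (Num.truncn (k%:R / eps)).+1.
have n_gt0 : 0 < n%:R :> R by rewrite ltr0n.
have n_big : k%:R <= n%:R * eps.
  by rewrite -ler_pdivrMr // ltW // truncnS_gt.
pose N : int := n%:Z *+ 3.
have NE : N%:~R = n%:R * 3 :> R by rewrite rmorphMn /= mulr_natr.
pose q := phi `^ (n%:R * 3)^-1.
have phi_gt0 : 0 < phi by exact: lt_trans phi_gt1.
have qXE (z : int) : q ^ z = phi `^ (z%:~R / (n%:R * 3)).
  by rewrite -powR_intmul ?powR_ge0 // -powRrM mulrC.
have qN : q ^ N = phi.
  by rewrite qXE NE divff ?powRr1 ?ltW // mulf_neq0 ?lt0r_neq0.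
have q_gt1 : 1 < q.
  rewrite -[ltLHS](powRr0 phi) /q /powR (gt_eqF phi_gt0).
  by rewrite ltr_expR ltr_pM2r ?ln_gt0 // invr_gt0 mulr_gt0.
have [|s [c [g [sz_s s_in [ts ts_ok <-] le_g]]]] :=
  @adversary_wins (holds q A) n%:Z k _ k_ge2; first by [].
have p_adm : admissible phi (prices q s).
  by rewrite -qN; exact: admissible_prices s_in.
apply: (@le_trans _ _
  (opt k (prices q s) / trading_return (prices q s) (trades A (prices q s)))%:E);
  last by apply: ereal_sup_ubound; exists (prices q s).
rewrite lee_fin trading_return_trades_prices //.
apply: (@le_trans _ _ (q ^ (log_gain s ts - log_value (holds q A) s))).
  rewrite qXE; apply: ler_powR; first exact: ltW.
  have : (n%:Z * (2 * k + 2)%:Z - k%:Z)%:~R <=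
      (log_gain s ts - log_value (holds q A) s)%:~R :> R by rewrite ler_int.
  rewrite ler_pdivlMr ?mulr_gt0 // rmorphB rmorphM /=.
  by rewrite -!pmulrn => le_gR; have := ler0n R k; lra.
rewrite expz_sub // ler_pM2r; last first.
  by rewrite invr_gt0 exprz_gt0 // (lt_trans _ q_gt1).
rewrite -(trading_return_prices q_gt1 ts_ok).
apply: opt_ge p_adm _; first exact: ltW.
by rewrite /feasible size_map.
Qed.
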